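(* Let $X$ be a dense in itself metric space. If $Q$ is a dense subset of $X$, then for each nowhere dense subset $F$ of $X$ there exists a set $G\subseteq Q$ which is nowhere dense in $Q$ (with the subspace topology) and such that $F\subseteq\mathrm{cl}_X G$, where $\mathrm{cl}_X$ denotes closure in $X$.
   Context: A space is dense in itself if it has no isolated points. *)

(* Defs.v *)
From mathcomp Require Import all_boot all_order all_algebra.
From mathcomp Require Import all_classical all_reals all_analysis.

Set Implicit Arguments.
Unset Strict Implicit.
Unset Printing Implicit Defensive.

Local Open Scope classical_set_scope.

Definition dense_in_itself (T : topologicalType) : Prop :=
  forall x : T, ~ isolated [set: T] x.

Definition nowhere_dense (T : topologicalType) (A : set T) : Prop :=
  interior (closure A) = set0.

(* Main.v *)
(* For each n pick a maximal 1/(n+1)-separated set A_n of points of F, and move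
   every a in A_n to a point of Q at distance less than 1/(4(n+1)); let G collect
   all the moved points.  Maximality gives F in cl G.  The n-th layer of G is
   still 1/(2(n+1))-separated, and near a point outside cl F only finitely many
   layers are visible, so all limit points of G lie in cl F.  As cl F has empty
   interior and X has no isolated points, no nonempty open set of Q is contained
   in the closure of G. *)
Require Import Defs.
From mathcomp Require Import all_boot all_order all_algebra.
From mathcomp Require Import all_classical all_reals all_analysis.
From mathcomp Require Import lra.

Set Implicit Arguments.
Unset Strict Implicit.
Unset Printing Implicit Defensive.

Import Order.TTheory GRing.Theory Num.Theory.

Local Open Scope classical_set_scope.
Local Open Scope ring_scope.

Definition dist_separated (R : realFieldType) (X : metricType R) (e : R)
    (A : set X) : Prop :=
  forall x y, A x -> A y -> x != y -> e <= mdist x y.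

(** Zorn's lemma applies because any two points in the union of a chain lie in a common member. A
    point of [F] at distance at least [e] from all of [A] could be added to [A]. *)
Lemma maximal_dist_separated (R : realFieldType) (X : metricType R) (e : R)
    (F : set X) : 0 < e ->
  exists A, [/\ A `<=` F, dist_separated e A &
    forall x, F x -> exists2 a, A a & mdist x a < e].
Proof.
move=> e0.
have [C CP totC|A [[AF sepA] maxA]] :=
    @Zorn_bigcup X [set A | A `<=` F /\ dist_separated e A].
  split=> [x [B CB Bx]|x y [B CB Bx] [D CD Dy]]; first by have [+ _] := CP _ CB; exact.
  have [BD|DB] := totC _ _ CB CD.
    by have [_] := CP _ CD; apply=> //; exact: BD.
  by have [_] := CP _ CB; apply=> //; exact: DB.
exists A; split=> // x Fx.
have [//|nAx] := pselect (exists2 a, A a & mdist x a < e).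
have far a : A a -> e <= mdist x a.
  by move=> Aa; rewrite leNgt; apply/negP => xa; apply: nAx; exists a.
have Ax : ~ A x by move=> /far; rewrite mdistxx leNgt e0.
exfalso; apply: (maxA (x |` A)).
  by split=> [|/(_ x (or_introl erefl))//]; exact: subsetUr.
split=> [y [->//|/AF//]|y z [->|Ay] [->|Az]]; first by rewrite eqxx.
- by move=> _; exact: far.
- by move=> _; rewrite metric_sym; exact: far.
- exact: sepA.
Qed.

(** The ball of radius [e / 2] around [x] contains at most one point of [A]; if that is some [z]
    other than [x], shrinking the radius to [mdist x z] excludes it. *)
Lemma dist_separated_near (R : realFieldType) (X : metricType R) (e : R)
    (A : set X) (x : X) : 0 < e -> dist_separated e A ->
  \forall y \near x, A y -> y = x.
Proof.
move=> e0 sepA.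
have [[z [Az zx xz]]|noz] :=
    pselect (exists z, [/\ A z, z != x & mdist x z < e / 2]); last first.
  apply/nbhs_ballP; exists (e / 2) => /=; first by lra.
  move=> y; rewrite ballEmdist /= => xy Ay; apply/eqP/negPn/negP => yx.
  by apply: noz; exists y.
have dxz : 0 < mdist x z by rewrite mdist_gt0 eq_sym.
apply/nbhs_ballP; exists (mdist x z) => //= y; rewrite ballEmdist /= => xy Ay.
have zy : z != y by apply: contraTneq xy => ->; rewrite ltxx.
exfalso; have := sepA _ _ Az Ay zy; have := metric_triangle z x y.
rewrite (metric_sym z x); lra.
Qed.

Lemma dense_ball (R : realFieldType) (X : metricType R) (Q : set X) (x : X)
    (e : R) : dense Q -> 0 < e -> exists2 q, Q q & mdist x q < e.
Proof.
move=> dQ e0.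
have xb : nbhs x (ball x e) by apply/nbhs_ballP; exists e.
have [||q [/interior_subset xq Qq]] := dQ (ball x e)^°.
- by exists x.
- exact: open_interior.
by exists q => //; move: xq; rewrite ballEmdist.
Qed.

Lemma dense_discrete_approximation (R : realType) (X : metricType R)
    (Q F : set X) : dense Q ->
  exists G, [/\ G `<=` Q, F `<=` closure G & limit_point G `<=` closure F].
Proof.
move=> dQ; pose e n : R := n.+1%:R^-1.
have e0 n : 0 < e n by rewrite invr_gt0.
have /choice[A AP] n := maximal_dist_separated F (e0 n).
have e4 n : 0 < e n / 4 by rewrite divr_gt0.
have /choice[q qP] : forall p : nat * X,
    exists q, Q q /\ mdist p.2 q < e p.1 / 4.
  by move=> [n a]; have [q] := dense_ball a dQ (e4 n); exists q.
pose G n := [set q (n, a) | a in A n].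
(* Each end of a pair at distance at least [e n] moves by less than [e n / 4]. *)
have sepG n : dist_separated (e n / 2) (G n).
  move=> _ _ [a Aa <-] [b Ab <-] qab.
  have ab : a != b by apply: contraNneq qab => ->.
  have [_ /(_ a b Aa Ab ab) + _] := AP n.
  have [_ /=] := qP (n, a); have [_ /=] := qP (n, b).
  have := metric_triangle a (q (n, a)) b.
  have := metric_triangle (q (n, a)) (q (n, b)) b.
  rewrite (metric_sym (q (n, b)) b); lra.
exists (\bigcup_n G n); split=> [_ [n _ [a _ <-]]|x Fx B /nbhs_ballP[r /= r0 rB]|].
- by have [] := qP (n, a).
- have r2 : 0 < r / 2 by rewrite divr_gt0.
  have [n _ /(_ n (leqnn n)) /= enr] := near_infty_natSinv_lt (PosNum r2).
  have [_ _ /(_ x Fx) [a Aa xa]] := AP n.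
  exists (q (n, a)); split; first by exists n => //; exists a.
  apply: rB; rewrite ballEmdist /=.
  have [_ /=] := qP (n, a); have := metric_triangle x a (q (n, a)).
  move: enr xa (e0 n); rewrite -/(e n); lra.
- move=> x; apply: contraPP => /existsNP[B /not_implyP[/nbhs_ballP[r /= r0 rB] FB]].
  have r2 : 0 < r / 2 by rewrite divr_gt0.
  have [n _ enr] := near_infty_natSinv_lt (PosNum r2).
  (* The finitely many layers below [n] have no point other than [x] near [x]. A point of a later
     layer within [r / 2] of [x] would come from a point of [F] within [r] of [x], hence in [B]. *)
  have nearG : \forall y \near x, forall k : 'I_n, G k y -> y = x.
    apply: filter_forall => k; apply: (dist_separated_near _ _ (sepG k)).
    by rewrite divr_gt0.
  have xr : nbhs x (ball x (r / 2)) by apply/nbhs_ballP; exists (r / 2).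
  move=> /(_ _ (filterI xr nearG)) [y [yx [k _ [a Aa qy]] [xy yG]]].
  have [kn|nk] := ltnP k n.
    by move/eqP: yx; apply; apply: (yG (Ordinal kn)); exists a.
  apply: FB; exists a; split; first by have [+ _ _] := AP k; exact.
  apply: rB; move: xy; rewrite !ballEmdist /= -qy => xy.
  have [_ /=] := qP (k, a); have := metric_triangle x (q (k, a)) a.
  rewrite (metric_sym (q (k, a)) a).
  move: (enr k nk) (e0 k) => /=; rewrite -/(e k); lra.
Qed.

(** Only limit points of [G] are controlled: [G] itself may leave [closure F], but there its points
    are isolated in [G], and a space without isolated points leaves room beside them. *)
Lemma nowhere_dense_limit_point (T : topologicalType) (Q F G : set T) :
  accessible_space T -> dense_in_itself T -> dense Q -> nowhere_dense F ->
  limit_point G `<=` closure F ->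
  nowhere_dense ((set_val : set_type Q -> T) @^-1` G).
Proof.
move=> T1 dT dQ nF GF; apply/seteqP; split=> // p.
move=> [_ [[U oU <-] /= Up UG]].
have [x Ux Fx] : exists2 x, U x & ~ closure F x.
  apply/not_exists2P => UF; suff: (closure F)^° (set_val p) by rewrite nF.
  apply: filterS (open_nbhs_nbhs (conj oU Up)) => x Ux.
  by have [|/contrapT] := UF x.
have : ~ limit_point G x by move/GF.
(* [V] meets [G] at most in [x]. *)
rewrite not_limit_pointE => -[V xV GV].
pose W := U `&` V^°.
have oW : open W by apply: openI => //; exact: open_interior.
have [y Wy yx] : exists2 y, W y & y != x.
  apply/not_exists2P => Wx; apply: (dT x); split; first exact: in_setT.
  exists W; first exact: open_nbhs_nbhs.
  rewrite setIT; apply/seteqP; split=> [y Wy|_ ->]; last by split.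
  by have [//|/negP/negPn/eqP] := Wx y.
(* This nonempty open set misses [G], yet it contains a point of [Q] lying in [U], hence in the
   closure of [G] relative to [Q]. *)
have oWx : open (W `\ x).
  by apply: openI => //; exact/closed_openC/accessible_closed_set1.
have [||z [[[Uz Vz] zx] Qz]] := dQ (W `\ x) => //.
  by exists y; split=> //; exact/eqP.
pose z' : set_type Q := SigSub (mem_set Qz).
have : closure ((set_val : set_type Q -> T) @^-1` G) z' by exact: UG.
have : nbhs z' ((set_val : set_type Q -> T) @^-1` (W `\ x)).
  apply: (@initial_continuous _ _ (set_val : set_type Q -> T) z').
  by apply: open_nbhs_nbhs; split.
move=> nz /(_ _ nz) [w [/= Gw [[_ /interior_subset Vw] wx]]].
exact/wx/GV.
Qed.

Local Close Scope ring_scope.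

(* The type [set_type Q] carries the subspace topology of [Q]. *)
Theorem lemma10 (R : realType) (X : metricType R) (hX : dense_in_itself X)
    (Q : set X) (hQ : dense Q) (F : set X) (hF : nowhere_dense F) :
  exists G : set X,
    [/\ G `<=` Q,
        nowhere_dense ((set_val : set_type Q -> X) @^-1` G) &
        F `<=` closure G].
Proof.
have [G [GQ FG GF]] := dense_discrete_approximation F hQ.
exists G; split=> //; apply: nowhere_dense_limit_point hF GF => //.
exact/hausdorff_accessible/metric_hausdorff.
Qed.
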